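(* Let $m=10+12q$ with $q=1+4d$ for a nonnegative integer $d$. The minimal decomposition of $\mathbb{Z}_2$ for the Fibonacci polynomial $F_m$ is $$\mathbb{Z}_2=\{0\}\sqcup\Bigl(\bigl(\bigcup_{k=0}^{7}A_k\bigr)\cup\bigl(\bigcup_{n\ge 1}\bigcup_{k=0}^{1}M_{n,k}\bigr)\Bigr),$$ where $A_k=(1+4k+2^5\mathbb{Z}_2)\cup(15-4k+2^5\mathbb{Z}_2)$ and $M_{n,k}=\bigl((1+4k)2^n+2^{n+3}\mathbb{Z}_2\bigr)\cup\bigl((3+4k)2^n+2^{n+3}\mathbb{Z}_2\bigr)$. Here $\{0\}$ is the set of a fixed point, and the $A_k$'s and $M_{n,k}$'s are the minimal components.
   Context: $\mathbb{Z}_2$ is the ring of 2-adic integers with the 2-adic metric. The Fibonacci polynomials are defined by $F_0(x)=0$, $F_1(x)=1$, $F_m(x)=xF_{m-1}(x)+F_{m-2}(x)$ for $m\ge 2$. For a polynomial $f$ over $\mathbb{Z}_2$, a minimal decomposition of $\mathbb{Z}_2$ for $f$ is a decomposition $\mathbb{Z}_2=\mathcal P\sqcup\mathcal M\sqcup\mathcal B$ (some parts possibly empty) in which: $\mathcal P$ is the finite set consisting of all periodic points of $f$; $\mathcal M=\bigsqcup_i\mathcal M_i$ is the union of all (at most countably many) clopen $f$-invariant sets $\mathcal M_i$ (the minimal components), each a finite union of balls, such that each $f:\mathcal M_i\to\mathcal M_i$ is minimal (every orbit is dense in $\mathcal M_i$); and each point of $\mathcal B$ lies in the attracting basin of a periodic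 orbit or of a minimal subsystem. *)

(* Defs.v *)
From HB Require Import structures.
From mathcomp Require Import all_boot all_order all_algebra.
From mathcomp Require Import all_classical all_reals all_analysis.

Set Implicit Arguments.
Unset Strict Implicit.
Unset Printing Implicit Defensive.

Import Order.TTheory GRing.Theory Num.Theory.

Local Open Scope classical_set_scope.
Local Open Scope ring_scope.

(* The ring of 2-adic integers as the inverse limit of the rings Z/2^n:      *)
(* [x n] is the residue of x modulo 2^n, represented in {0, ..., 2^n - 1}.   *)
Record Z2 := MkZ2 {
  Z2res :> nat -> nat;
  Z2resP : forall n, (Z2res n.+1 %% 2 ^ n)%N = Z2res n }.

Lemma Z2_ext (x y : Z2) : (forall n, x n = y n) -> x = y.
Proof.
case: x y => [x hx] [y hy] /= /funext exy; rewrite -{}exy in hy *.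
by congr MkZ2; exact: Prop_irrelevance.
Qed.

HB.instance Definition _ := gen_eqMixin Z2.
HB.instance Definition _ := gen_choiceMixin Z2.

Section Z2_zmod.
Implicit Types (x y z : Z2) (n : nat).

Lemma Z2res_lt x n : (x n < 2 ^ n)%N.
Proof. by rewrite -Z2resP ltn_mod expn_gt0. Qed.

Lemma Z2res_mod x n : (x n %% 2 ^ n)%N = x n.
Proof. by rewrite modn_small // Z2res_lt. Qed.

Let dvd2 n : (2 ^ n %| 2 ^ n.+1)%N.
Proof. by rewrite dvdn_exp2l. Qed.

Fact Z2_natP k n : ((k %% 2 ^ n.+1) %% 2 ^ n = k %% 2 ^ n)%N.
Proof. by rewrite modn_dvdm. Qed.

Definition Z2_nat k := MkZ2 (Z2_natP k).

Fact Z2_addP x y n :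
  (((x n.+1 + y n.+1) %% 2 ^ n.+1) %% 2 ^ n = (x n + y n) %% 2 ^ n)%N.
Proof. by rewrite modn_dvdm // -modnDm !Z2resP. Qed.

Definition Z2_add x y := MkZ2 (Z2_addP x y).

Fact Z2_oppP x n :
  (((2 ^ n.+1 - x n.+1) %% 2 ^ n.+1) %% 2 ^ n = (2 ^ n - x n) %% 2 ^ n)%N.
Proof.
rewrite modn_dvdm //; apply/eqP; rewrite -(eqn_modDr (x n.+1)).
rewrite subnK; last exact/ltnW/Z2res_lt.
rewrite -[X in _ == X]modnDmr Z2resP subnK; last exact/ltnW/Z2res_lt.
by rewrite modnn -/(dvdn _ _).
Qed.

Definition Z2_opp x := MkZ2 (Z2_oppP x).

Fact Z2_mulP x y n :
  (((x n.+1 * y n.+1) %% 2 ^ n.+1) %% 2 ^ n = (x n * y n) %% 2 ^ n)%N.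
Proof. by rewrite modn_dvdm // -modnMm !Z2resP. Qed.

Definition Z2_mul x y := MkZ2 (Z2_mulP x y).

Fact Z2_addA : associative Z2_add.
Proof. by move=> x y z; apply: Z2_ext => n /=; rewrite modnDml modnDmr addnA. Qed.

Fact Z2_addC : commutative Z2_add.
Proof. by move=> x y; apply: Z2_ext => n /=; rewrite addnC. Qed.

Fact Z2_add0 : left_id (Z2_nat 0) Z2_add.
Proof. by move=> x; apply: Z2_ext => n /=; rewrite mod0n add0n Z2res_mod. Qed.

Fact Z2_addN : left_inverse (Z2_nat 0) Z2_opp Z2_add.
Proof.
move=> x; apply: Z2_ext => n /=.
by rewrite modnDml subnK ?modnn ?mod0n //; exact/ltnW/Z2res_lt.
Qed.

End Z2_zmod.

HB.instance Definition _ :=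
  GRing.isZmodule.Build Z2 Z2_addA Z2_addC Z2_add0 Z2_addN.

Section Z2_ring.
Implicit Types (x y z : Z2) (n : nat).

Fact Z2_mulA : associative Z2_mul.
Proof. by move=> x y z; apply: Z2_ext => n /=; rewrite modnMml modnMmr mulnA. Qed.

Fact Z2_mulC : commutative Z2_mul.
Proof. by move=> x y; apply: Z2_ext => n /=; rewrite mulnC. Qed.

Fact Z2_mul1 : left_id (Z2_nat 1) Z2_mul.
Proof. by move=> x; apply: Z2_ext => n /=; rewrite modnMml mul1n Z2res_mod. Qed.

Fact Z2_mulD : left_distributive Z2_mul Z2_add.
Proof.
by move=> x y z; apply: Z2_ext => n /=; rewrite modnMml modnDm mulnDl.
Qed.

Fact Z2_oner_neq0 : Z2_nat 1 != 0.
Proof. by apply/eqP => /(congr1 (fun x : Z2 => x 1%N)). Qed.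

End Z2_ring.

HB.instance Definition _ := GRing.Zmodule_isComNzRing.Build Z2
  Z2_mulA Z2_mulC Z2_mul1 Z2_mulD Z2_oner_neq0.

Section Z2_metric.
Implicit Types (x y z : Z2) (n : nat).

(* |x|_2 = 2^-v, where v + 1 is the least n such that x is nonzero mod 2^n.  *)
Definition Z2abs x : rat :=
  if pselect (exists n, x n != 0%N) is left h then 2 ^- (ex_minn h).-1 else 0.

Lemma Z2res0 x n m : (m <= n)%N -> x n = 0%N -> x m = 0%N.
Proof.
elim: n => [|n IH]; first by rewrite leqn0 => /eqP ->.
rewrite leq_eqVlt => /predU1P[-> //|]; rewrite ltnS => mn x0.
by apply: IH => //; rewrite -Z2resP x0 mod0n.
Qed.

Lemma Z2abs_le x n : (Z2abs x <= 2 ^- n) = (x n == 0%N).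
Proof.
rewrite /Z2abs; case: pselect => [h|h]; last first.
  rewrite invr_ge0 exprn_ge0 //; apply/esym/negPn/negP => xn.
  by apply: h; exists n.
case: ex_minnP => -[|m] xm minm.
  by move: (Z2res_lt x 0); rewrite expn0 ltnS leqn0 (negPf xm).
rewrite /= lef_pV2 ?posrE ?exprn_gt0 // ler_eXn2l ?ltr1n //.
apply/idP/eqP => [nm|xn].
  by apply: contraTeq isT => /minm; rewrite ltnNge nm.
by rewrite -ltnS ltnNge; apply: contra xm => /Z2res0/(_ xn)/eqP.
Qed.

Lemma Z2abs0 : Z2abs 0 = 0.
Proof.
rewrite /Z2abs; case: pselect => [h|//]; exfalso.
by case: h => n; rewrite /= mod0n eqxx.
Qed.

Lemma Z2abs_eq0 x : Z2abs x = 0 -> x = 0.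
Proof.
move=> x0; apply: Z2_ext => n /=; rewrite mod0n; apply/eqP.
by rewrite -Z2abs_le x0 invr_ge0 exprn_ge0.
Qed.

Lemma Z2abs_cases x : Z2abs x = 0 \/ exists n, Z2abs x = 2 ^- n.
Proof.
rewrite /Z2abs; case: pselect => [h|_]; last by left.
by right; exists (ex_minn h).-1.
Qed.

Lemma Z2abs_ge0 x : 0 <= Z2abs x.
Proof.
by case: (Z2abs_cases x) => [->|[n ->]] //; rewrite invr_ge0 exprn_ge0.
Qed.

Lemma Z2resN0 x n : x n = 0%N -> (- x) n = 0%N.
Proof. by rewrite /= => ->; rewrite subn0 modnn. Qed.

Lemma Z2absN x : Z2abs (- x) = Z2abs x.
Proof.
have le y : Z2abs (- y) <= Z2abs y.
  case: (Z2abs_cases y) => [/[dup] y0 /Z2abs_eq0 ->|[n yn]].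
    by rewrite oppr0.
  by rewrite yn Z2abs_le; apply/eqP/Z2resN0/eqP; rewrite -Z2abs_le yn.
by apply/eqP; rewrite eq_le le -{1}(opprK x) le.
Qed.

Lemma Z2abs_ultra x y : Z2abs (x + y) <= Num.max (Z2abs x) (Z2abs y).
Proof.
wlog xy : x y / Z2abs x <= Z2abs y => [wl|].
  case: (leP (Z2abs x) (Z2abs y)) => [xy|/ltW yx].
    by rewrite -(max_r xy) wl.
  by rewrite -(max_l yx) addrC maxC wl.
rewrite le_max; apply/orP; right.
case: (Z2abs_cases y) => [y0|[n yn]].
  move: xy; rewrite y0 => x0; rewrite (Z2abs_eq0 y0) addr0 //.
move: xy; rewrite yn !Z2abs_le => /eqP x0.
have /eqP y0 : y n == 0%N by rewrite -Z2abs_le yn.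
by rewrite /= x0 y0 mod0n.
Qed.

Definition Z2dist x y : rat := Z2abs (x - y).

Fact Z2distxx x : Z2dist x x = 0.
Proof. by rewrite /Z2dist subrr Z2abs0. Qed.

Fact Z2dist_eq0 x y : Z2dist x y = 0 -> x = y.
Proof. by move/Z2abs_eq0/eqP; rewrite subr_eq0 => /eqP. Qed.

Fact Z2dist_sym x y : Z2dist x y = Z2dist y x.
Proof. by rewrite /Z2dist -opprB Z2absN. Qed.

Fact Z2dist_triangle y x z : Z2dist x z <= Z2dist x y + Z2dist y z.
Proof.
have -> : Z2dist x z = Z2abs ((x - y) + (y - z)) by rewrite addrA subrK.
apply: (le_trans (Z2abs_ultra _ _)).
by rewrite ge_max lerDl lerDr !Z2abs_ge0.
Qed.

End Z2_metric.

(* The distance takes its values in {0} U {2^-n}, hence the scalars [rat].   *)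
HB.instance Definition _ :=
  isMetric.Build rat Z2 Z2distxx Z2dist_eq0 Z2dist_sym Z2dist_triangle.

Fixpoint fibp (R : nzRingType) (n : nat) : {poly R} :=
  match n with
  | 0 => 0
  | n1.+1 => match n1 with
             | 0 => 1
             | n2.+1 => 'X * fibp R n1 + fibp R n2
             end
  end.

Section dynamics.
Implicit Types (f : {poly Z2}) (x y : Z2) (E : set Z2).

Definition forward_orbit f x : set Z2 := range (fun n => iter n (horner f) x).

Definition periodic_points f : set Z2 :=
  [set x | exists2 n, (0 < n)%N & iter n (horner f) x = x].

Definition finite_union_of_balls E : Prop :=
  exists2 s : seq (Z2 * rat), (forall b, b \in s -> 0 < b.2) &
    E = \bigcup_(b in [set` s]) ball b.1 b.2.

Definition fwd_invariant f E : Prop := horner f @` E `<=` E.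

Definition minimal_on f E : Prop :=
  E !=set0 /\ forall x, E x -> E `<=` closure (forward_orbit f x).

Definition minimal_component f E : Prop :=
  [/\ clopen E, finite_union_of_balls E, fwd_invariant f E & minimal_on f E].

(* The points x whose distance from f^n(x) to E tends to 0.                  *)
Definition attracting_basin f E : set Z2 :=
  [set x | forall e : rat, 0 < e ->
    \forall n \near \oo, exists2 y, E y & ball y e (iter n (horner f) x)].

(* The minimal components are the sets [C i], for i in D.                    *)
Record minimal_decomposition f (P M B : set Z2)
    (I : Type) (D : set I) (C : I -> set Z2) : Prop := MinimalDecomposition {
  md_cover : setT = P `|` M `|` B;
  md_disjPM : P `&` M = set0;
  md_disjPB : P `&` B = set0;
  md_disjMB : M `&` B = set0;
  md_periodic : P = periodic_points f;
  md_finite : finite_set P;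
  md_countable : countable D;
  md_union : M = \bigcup_(i in D) C i;
  md_trivIset : trivIset D C;
  md_components : C @` D = [set E | minimal_component f E];
  md_basin : forall x, B x ->
    (exists2 y, periodic_points f y & attracting_basin f (forward_orbit f y) x) \/
    (exists2 i, D i & attracting_basin f (C i) x) }.

End dynamics.

(* a + 2^n Z_2 *)
Definition coset2 (a : Z2) (n : nat) : set Z2 :=
  [set a + 2 ^+ n * z | z in [set: Z2]].

Definition Acomp (k : nat) : set Z2 :=
  coset2 (1 + 4 * k%:R) 5%N `|` coset2 (15 - 4 * k%:R) 5%N.

Definition Mcomp (n k : nat) : set Z2 :=
  coset2 ((1 + 4 * k%:R) * 2 ^+ n) (n + 3)%N `|`
  coset2 ((3 + 4 * k%:R) * 2 ^+ n) (n + 3)%N.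

(* [inl k] indexes A_k and [inr (n, k)] indexes M_{n,k}. *)
Definition fib_index : set (nat + nat * nat) :=
  [set i | match i with
           | inl k => (k <= 7)%N
           | inr (n, k) => (1 <= n)%N /\ (k <= 1)%N
           end].

Definition fib_component (i : nat + nat * nat) : set Z2 :=
  match i with
  | inl k => Acomp k
  | inr (n, k) => Mcomp n k
  end.

(* Main.v *)
Require Import Defs.
From HB Require Import structures.
From mathcomp Require Import all_boot all_order all_algebra.
From mathcomp Require Import all_classical all_reals all_analysis.
From mathcomp Require Import ring zify.

Set Implicit Arguments.
Unset Strict Implicit.
Unset Printing Implicit Defensive.

Import Order.TTheory GRing.Theory Num.Theory.

Local Open Scope classical_set_scope.
Local Open Scope ring_scope.

(** Write [f] for [F_m], with [m = 22 + 48 * d]. As [m] is even, [f] is an odd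
    polynomial and fixes [0]. On each of the announced sets, [f \o f] acts as an
    odometer: this makes the set minimal and excludes other periodic points.

    The dynamical input is an elementary criterion. Suppose that on a union [E]
    of cosets of [2 ^ N] a map [g] satisfies [g x = x + 2 ^ N * u] with [u] odd,
    and [g x - g y = (x - y) * (1 + 4 * w)] whenever [x] and [y] are congruent
    modulo [2 ^ N]. Then [g \o g] satisfies the same two conditions at level
    [N + 1] ([odometer_double]): applying the second condition to [g x] and [x],
    the step [g (g x) - x] is the step [g x - x] times [2 * (1 + 2 * w)]. Hence
    the [2 ^ k]-th iterate moves every point by an odd multiple of
    [2 ^ (N + k)]. Correcting one binary digit at a time, the orbit of [x]
    reaches every coset of [2 ^ (N + k)] inside [x + 2 ^ N Z_2]
    ([odometer_transitive]), and no iterate has a fixed point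
    ([odometer_aperiodic]).

    This is applied to [g = f \o f] and to two cosets of [2 ^ N] exchanged by
    [f] ([swapped_cosets_minimal]); their union is then a minimal component.
    The arithmetic input concerns the divided difference [fibdd], defined by
    [F_m(x) - F_m(y) = (x - y) * fibdd x y m].
    - It is [3] modulo [4] whenever [x] and [y] have the same parity
      ([fibdd_mod4]), so that its product over two successive points of the
      orbits is [1] modulo [4]: this is the second condition above.
    - For [x] even, [F_m(x) = x * fibdd x 0 m] with a cofactor congruent to [3]
      or [11] modulo [16] ([fibdd_even]), whence [f (2 ^ n * v)] is
      [2 ^ n * (3 * v)] modulo [2 ^ (n + 3)], which exchanges the two cosets of
      [M_{n,k}]; the product of two such cofactors is [9] modulo [16], so that
      [f (f x) - x] is an odd multiple of [2 ^ (n + 3)].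
    - For [x] odd, [f x = 16 - x] modulo [32] and [f (f x) = x + 32] modulo [64]
      ([fibp_odd]), which are the corresponding facts for [A_k].
    All of these are congruences modulo a fixed power of [2]. Modulo such a
    power, consecutive values of [F_m] and [fibdd] form a sequence produced by
    iterating a map on a finite set, with period [48] or [96] in [m] on the
    residues that matter, so that a finite computation settles every [d].

    Finally, a nonzero 2-adic integer is [2 ^ n * u] with [u] odd, which places
    it in exactly one component. A minimal component is open, hence contains a
    nonzero point, and two minimal components with a common point are equal: so
    there are no others. *)

(** * Residues of 2-adic integers *)

Section Residues.
Implicit Types (x y z u v : Z2) (n m k : nat).

Lemma Z2resD x y n : (x + y) n = ((x n + y n) %% 2 ^ n)%N. Proof. by []. Qed.
Lemma Z2resM x y n : (x * y) n = ((x n * y n) %% 2 ^ n)%N. Proof. by []. Qed.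
Lemma Z2res_zero n : (0 : Z2) n = 0%N. Proof. exact: mod0n. Qed.

Lemma Z2res_natr k n : (k%:R : Z2) n = (k %% 2 ^ n)%N.
Proof.
elim: k => [|k IH]; first by rewrite Z2res_zero mod0n.
by rewrite -natr1 Z2resD IH /= modnDm addn1.
Qed.

Lemma Z2res_modn x m n : (m <= n)%N -> (x n %% 2 ^ m)%N = x m.
Proof.
elim: n => [|n IH]; first by rewrite leqn0 => /eqP ->; rewrite Z2res_mod.
rewrite leq_eqVlt => /predU1P[-> |]; first by rewrite Z2res_mod.
rewrite ltnS => mn; rewrite -IH // -(Z2resP x n) modn_dvdm //.
exact: dvdn_exp2l.
Qed.

Lemma Z2res_le x y m n : (m <= n)%N -> x n = y n -> x m = y m.
Proof. by move=> mn xy; rewrite -(Z2res_modn x mn) xy Z2res_modn. Qed.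

Lemma Z2res_mul2X n x k : (2 ^+ n * x) (n + k)%N = (2 ^ n * x k)%N.
Proof.
rewrite -natrX Z2resM Z2res_natr modnMml expnD -muln_modr.
by rewrite (Z2res_modn _ (leq_addl _ _)).
Qed.

Lemma Z2res_mul2X0 n x : (2 ^+ n * x) n = 0%N.
Proof.
by have := Z2res_mul2X n x 0; rewrite addn0 -(Z2res_mod x 0) modn1 muln0.
Qed.

(** The quotient is read off the residues of [x]: its residue modulo [2 ^ k]
    is that of [x] modulo [2 ^ (n + k)], divided by [2 ^ n]. *)
Lemma Z2_div2X x n : x n = 0%N -> exists z, x = 2 ^+ n * z.
Proof.
move=> xn.
have dvd k : (2 ^ n %| x (n + k))%N.
  by rewrite /dvdn (Z2res_modn _ (leq_addr _ _)) xn.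
have quoP k : ((x (n + k.+1) %/ 2 ^ n) %% 2 ^ k = x (n + k) %/ 2 ^ n)%N.
  apply/eqP; rewrite -(eqn_pmul2l (expn_gt0 2 n)) muln_modr -expnD.
  rewrite ![(2 ^ n * (_ %/ _))%N]mulnC !divnK ?dvd //.
  by rewrite Z2res_modn // leq_add2l.
exists (MkZ2 quoP); apply: Z2_ext => k.
apply: (@Z2res_le _ _ _ (n + k)); first exact: leq_addl.
by rewrite Z2res_mul2X /= mulnC divnK ?dvd.
Qed.

Lemma Z2_eqresP x y n : x n = y n <-> exists z, x = y + 2 ^+ n * z.
Proof.
split=> [xy|[z ->]]; last by rewrite Z2resD Z2res_mul2X0 addn0 Z2res_mod.
have /Z2_div2X[z xyz] : (x - y) n = 0%N.
  by rewrite Z2resD xy -Z2resD subrr Z2res_zero.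
by exists z; rewrite -xyz addrC subrK.
Qed.

Lemma coset2P a n x : coset2 a n x <-> x n = a n.
Proof.
rewrite Z2_eqresP; split=> [[z _ <-]|[z ->]]; first by exists z.
by exists z.
Qed.

Lemma Z2res_addX x n u : (x + 2 ^+ n * u) n.+1 =
  ((x n.+1 + 2 ^ n * u 1) %% 2 ^ n.+1)%N.
Proof. by rewrite Z2resD; have := Z2res_mul2X n u 1; rewrite addn1 => ->. Qed.

Lemma Z2res1 x : x 1 = odd (x 1).
Proof. by have := Z2res_lt x 1; case: (x 1) => [|[|]]. Qed.

Lemma Z2res_all (P : pred nat) n x : all P (iota 0 (2 ^ n)) -> P (x n).
Proof. by move/allP; apply; rewrite mem_iota Z2res_lt. Qed.

Lemma Z2_val x : x != 0 -> exists n u, u 1 = 1%N /\ x = 2 ^+ n * u.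
Proof.
move=> x0; have [n xn] : exists n, x n != 0%N.
  apply: contrapT => /forallNP h; move/eqP: x0; apply; apply: Z2_ext => n.
  by rewrite Z2res_zero; apply/eqP/negPn/negP/h.
elim: n xn => [|n IH] xn.
  by have := Z2res_lt x 0; rewrite expn0 ltnS leqn0 (negPf xn).
case: (eqVneq (x n) 0%N) => [xn0|/IH//].
have [u xE] := Z2_div2X xn0; exists n, u; split=> //.
move: xn; rewrite xE; have := Z2res_mul2X n u 1; rewrite addn1 => ->.
rewrite muln_eq0.
by rewrite expn_eq0 /=; have := Z2res_lt u 1; case: (u 1) => [|[|]].
Qed.

Lemma Z2_val_inj n m u v : u 1 = 1%N -> v 1 = 1%N ->
  2 ^+ n * u = 2 ^+ m * v -> n = m.
Proof.
wlog nm : n m u v / (n <= m)%N.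
  move=> wl u1 v1 e; case: (leqP n m) => [nm|/ltnW mn].
    exact: (wl n m u v).
  by apply/esym/(wl m n v u).
move=> u1 _ e; apply/eqP; rewrite eqn_leq nm leqNgt; apply/negP => {}nm.
have := Z2res_mul2X n u 1; rewrite u1 addn1 e => e1.
have := @Z2res_le (2 ^+ m * v) 0 _ _ nm.
rewrite Z2res_mul2X0 e1 !Z2res_zero muln1 => /(_ erefl)/eqP.
by rewrite expn_eq0.
Qed.

End Residues.

(** * Odometers *)

Section Odometer.
Implicit Types (x y z u v w : Z2) (n k N : nat) (g : Z2 -> Z2) (E : set Z2).

Lemma iter_double g k x : iter k (g \o g) x = iter k.*2 g x.
Proof. by elim: k => //= k ->. Qed.

(** The last condition says that the slope of [g] is [1] modulo [4] at the scale
    [2 ^ N]. The modulus [4] matters: with slope [-1] the map [g \o g] could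
    move points by more than one extra factor [2]. *)
Record odometer N E g : Prop := Odometer {
  odo_stable : forall x y, E x -> x N = y N -> E y;
  odo_step : forall x, E x -> exists u, u 1 = 1%N /\ g x = x + 2 ^+ N * u;
  odo_deriv : forall x y, E x -> x N = y N ->
    exists w, g x - g y = (x - y) * (1 + 4 * w) }.

Lemma odo_res N E g x : odometer N E g -> E x -> g x N = x N.
Proof. by move=> o /(odo_step o)[u [_ ->]]; rewrite Z2_eqresP; exists u. Qed.

Lemma odo_iter N E g x j : odometer N E g -> E x ->
  E (iter j g x) /\ iter j g x N = x N.
Proof.
move=> o Ex; elim: j => //= j [Ej xj]; rewrite (odo_res o) //; split=> //.
by apply: (odo_stable o Ej); rewrite (odo_res o).
Qed.

(** Squaring [g] doubles the step up to an odd factor: with [h = g x - x],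
    [g (g x) - x = h * (1 + 4 * w) + h = 2 * h * (1 + 2 * w)]. *)
Lemma odometer_double N E g : odometer N E g -> odometer N.+1 E (g \o g).
Proof.
move=> o; split=> [x y Ex /(Z2res_le (leqnSn N))|x Ex|x y Ex xy].
- exact: (odo_stable o).
- have [u [u1 gx]] := odo_step o Ex.
  have [w] := odo_deriv o Ex (esym (odo_res o Ex)).
  rewrite /= gx => e; exists (u * (1 + 2 * w)); split.
    rewrite Z2resM u1 Z2resD (Z2res_natr 1) Z2resM (Z2res_natr 2) /=.
    by rewrite mul0n.
  apply: (addrI (- (x + 2 ^+ N * u))); move: e => /(congr1 -%R).
  by rewrite opprB addrC => ->; rewrite exprS; ring.
- have {}xy := Z2res_le (leqnSn N) xy.
  have [w e] := odo_deriv o Ex xy.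
  have [|w'] := odo_deriv o (odo_stable o Ex (esym (odo_res o Ex))) (y := g y).
    rewrite !(odo_res o) //; exact: (odo_stable o Ex).
  rewrite /= => ->; rewrite e; exists (w + w' + 4 * w * w'); ring.
Qed.

Lemma odometer_iter N E g k :
  odometer N E g -> odometer (N + k) E (iter (2 ^ k) g).
Proof.
elim: k N g => [|k IH] N g o; first by rewrite addn0.
have -> : iter (2 ^ k.+1) g = iter (2 ^ k) (g \o g).
  by apply/funext => x; rewrite iter_double expnS mul2n.
by rewrite addnS -addSn; apply/IH/odometer_double.
Qed.

(** If the current point agrees with [y] up to the digit of rank [N + k] but not
    at that digit, then [2 ^ k] more steps flip this digit and keep the lower
    ones. *)
Lemma odometer_transitive N E g x y k : odometer N E g -> E x -> y N = x N ->
  exists j, iter j g x (N + k)%N = y (N + k)%N.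
Proof.
move=> o Ex yx; elim: k => [|k [j ej]]; first by exists 0%N; rewrite addn0.
have [Ez _] := odo_iter j o Ex; set z := iter j g x in ej Ez.
have [v yE] : exists v, y = z + 2 ^+ (N + k) * v by apply/Z2_eqresP.
have := Z2res1 v; case: (odd _) => [v1|v0]; last first.
  exists j; rewrite -/z addnS yE Z2res_addX v0 muln0 addn0.
  by rewrite Z2res_mod.
have [u [u1 gz]] := odo_step (odometer_iter k o) Ez.
exists (2 ^ k + j)%N; rewrite iterD -/z gz addnS yE !Z2res_addX u1 v1 //.
Qed.

Lemma odo_iter_step N E g x r : odometer N E g -> E x ->
  exists v, v 1 = odd r /\ iter r g x = x + 2 ^+ N * v.
Proof.
move=> o Ex; elim: r => [|r [v [v1 e]]].
  by exists 0; rewrite Z2res_zero mulr0 addr0.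
have [Er _] := odo_iter r o Ex; have [u [u1 /= ->]] := odo_step o Er.
exists (v + u); split; last by rewrite e; ring.
by rewrite Z2resD v1 u1 /=; case: (odd r).
Qed.

(** Write [p = r * 2 ^ k] with [r] odd: the [2 ^ k]-th iterate moves points by
    odd multiples of [2 ^ (N + k)], and an odd number of such moves cannot
    cancel modulo [2 ^ (N + k).+1]. *)
Lemma odometer_aperiodic N E g x p : odometer N E g -> E x -> (0 < p)%N ->
  iter p g x <> x.
Proof.
move=> o Ex p0; set k := logn 2 p.
have [r r2 pE] : exists2 r, odd r & p = (r * 2 ^ k)%N.
  have [//|r cop ->] := @pfactor_coprime 2 p isT.
  by exists r => //; rewrite coprime2n in cop.
have -> : iter p g x = iter r (iter (2 ^ k) g) x.
  by rewrite pE; elim: r {r2 pE} => //= r IH; rewrite mulSn iterD IH.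
have [v [v1 ->]] := odo_iter_step r (odometer_iter k o) Ex.
move/(congr1 (fun t : Z2 => t (N + k).+1)); rewrite Z2res_addX v1 r2 muln1.
set M := (N + k)%N => /eqP.
rewrite -[X in _ == X](Z2res_mod x) -[X in _ == (X %% _)%N]addn0 eqn_modDl.
by rewrite mod0n modn_small ?ltn_exp2l // expn_eq0.
Qed.

End Odometer.

(** * The 2-adic topology through residues *)

Section Topology.
Implicit Types (x y z : Z2) (n k N : nat) (E : set Z2).

(** The radius is twice the largest distance inside the coset; any radius in
    [[2 ^- n, 2 * 2 ^- n]], its left end excluded, would give the same ball. *)
Lemma Z2_ballE a n : ball a (2 * 2 ^- n : rat) = coset2 a n.
Proof.
rewrite ballEmdist; apply/seteqP; split=> x /=; rewrite coset2P.
  rewrite /mdist /= /Z2dist => lt_ax; apply/esym.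
  have : (a - x) n = 0%N.
    apply/eqP; rewrite -Z2abs_le; case: (Z2abs_cases (a - x)) => [-> | [m mE]].
      by rewrite invr_ge0 exprn_ge0.
    move: lt_ax; rewrite mE; case: n => [_|n].
      by rewrite lef_pV2 ?posrE ?exprn_gt0 // expr0 exprn_ege1 // ler1n.
    rewrite [in X in _ < X]exprS invfM mulVKf // ltf_pV2 ?posrE ?exprn_gt0 //.
    rewrite ltr_eXn2l ?ltr1n // => nm.
    by rewrite lef_pV2 ?posrE ?exprn_gt0 // ler_eXn2l ?ltr1n.
  move=> /Z2_div2X[z /eqP]; rewrite subr_eq addrC => /eqP ->.
  by apply/Z2_eqresP; exists z.
move=> xa; rewrite /mdist /= /Z2dist.
apply: (@le_lt_trans _ _ (2 ^- n)); last first.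
  by rewrite ltr_pMl ?ltr1n // invr_gt0 exprn_gt0.
by rewrite Z2abs_le Z2resD -xa -Z2resD subrr Z2res_zero.
Qed.

Lemma Z2_nbhsP x (P : set Z2) :
  nbhs x P <-> exists n, forall y, y n = x n -> P y.
Proof.
rewrite nbhs_ballP; split=> [[e /= e0 Pe]|[n Pn]].
  have [n ne] : exists n, 2 * 2 ^- n < e.
    have e2 : 0 < 2 / e by rewrite divr_gt0.
    exists (Num.bound (2 / e)).
    have := upper_nthrootP (leqnn (Num.bound (2 / e))).
    by rewrite ltr_pdivrMr // ltr_pdivrMr ?exprn_gt0 // mulrC.
  exists n => y yx; apply: Pe; apply: le_ball (ltW ne) _ _.
  by rewrite Z2_ballE coset2P.
exists (2 * 2 ^- n); first by rewrite /= mulr_gt0 // invr_gt0 exprn_gt0.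
by move=> y; rewrite Z2_ballE coset2P => /Pn.
Qed.

Lemma Z2_closureP E x :
  closure E x <-> forall n, exists2 y, E y & y n = x n.
Proof.
split=> [cl n|h B /Z2_nbhsP[n Bn]].
  have /cl[y [Ey yx]] : nbhs x [set y | y n = x n] by apply/Z2_nbhsP; exists n.
  by exists y.
by have [y Ey yx] := h n; exists y; split=> //; apply: Bn.
Qed.

Lemma clopen_residue N E : (forall x y, E x -> x N = y N -> E y) -> clopen E.
Proof.
move=> h; split.
  by rewrite openE => x Ex; apply/Z2_nbhsP; exists N => y /esym; apply: h.
move=> x /Z2_closureP/(_ N)[y Ey]; exact: h.
Qed.

End Topology.

(** * Fibonacci polynomials and their divided differences modulo powers of 2 *)

Section FibonacciResidues.

Lemma fibpS2 (R : comNzRingType) (x : R) n :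
  (fibp R n.+2).[x] = x * (fibp R n.+1).[x] + (fibp R n).[x].
Proof. by rewrite [fibp R n.+2]/= hornerD hornerM hornerX. Qed.

(** The divided difference of [F_m] between [x] and [y], as a polynomial
    expression: it makes sense for [x = y] too, where it is the derivative. The
    recurrence comes from
    [x * F(x) - y * F(y) = (x - y) * F(x) + y * (F(x) - F(y))]. *)
Fixpoint fibdd (R : comNzRingType) (x y : R) (m : nat) : R :=
  match m with
  | 0 => 0
  | m1.+1 => match m1 with
             | 0 => 0
             | m2.+1 => (fibp R m1).[x] + y * fibdd x y m1 + fibdd x y m2
             end
  end.

Lemma fibddS2 (R : comNzRingType) (x y : R) n :
  fibdd x y n.+2 = (fibp R n.+1).[x] + y * fibdd x y n.+1 + fibdd x y n.
Proof. by []. Qed.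

Lemma fibp_sub (R : comNzRingType) (x y : R) m :
  (fibp R m).[x] - (fibp R m).[y] = (x - y) * fibdd x y m.
Proof.
suff [] : (fibp R m).[x] - (fibp R m).[y] = (x - y) * fibdd x y m /\
  (fibp R m.+1).[x] - (fibp R m.+1).[y] = (x - y) * fibdd x y m.+1 by [].
elim: m => [|m [IH1 IH2]]; first by rewrite /= !hornerE; split; ring.
split=> //; rewrite fibddS2 !mulrDr -IH1 [in RHS]mulrCA -IH2 !fibpS2; ring.
Qed.

(** The residues modulo [M] of two consecutive values of [F_m(x)], and of two
    consecutive divided differences, for residues [x] and [y]. *)
Definition fib_step (M x y : nat) (s : nat * nat * (nat * nat)) :=
  let: ((a, b), (e, f)) := s in
  ((b, (x * b + a) %% M), (f, (b + y * f + e) %% M))%N.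

Definition fib_state (M x y m : nat) :=
  iter m (fib_step M x y) (0, 1, (0, 0))%N.

(* Simplification would unfold the tens of iterations of concrete states. *)
Arguments fib_state : simpl never.

Lemma fib_stateP (x y : Z2) n m : (0 < n)%N ->
  fib_state (2 ^ n) (x n) (y n) m =
  (((fibp Z2 m).[x] n, (fibp Z2 m.+1).[x] n),
   (fibdd x y m n, fibdd x y m.+1 n)).
Proof.
move=> n0; elim: m => [|m IH].
  rewrite /fib_state /= !hornerE !Z2res_zero (Z2res_natr 1).
  rewrite ?mod0n modn_small //=.
  by have := ltn_exp2l 0 n (isT : 1 < 2)%N; rewrite expn0 n0.
rewrite /fib_state iterS -/(fib_state _ _ _ m) IH fibddS2 fibpS2 [LHS]/=.
by rewrite !Z2resD !Z2resM modnDml modnDmr modnDml.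
Qed.

Lemma fib_state_periodic M x y p r e :
  fib_state M x y p = fib_state M x y 0 ->
  fib_state M x y (r + p * e) = fib_state M x y r.
Proof.
rewrite /fib_state iterD => per; congr iter.
by elim: e => [|e IH]; rewrite ?muln0 // mulnS iterD IH.
Qed.

(** The residues depend on [m] only modulo a period [p] of the state sequence;
    as the sequence is an orbit, [p] is a period as soon as the initial state
    recurs at time [p]. *)
Lemma fib_residues (x y : Z2) n m p r e : (0 < n)%N -> m = (r + p * e)%N ->
  fib_state (2 ^ n) (x n) (y n) p = fib_state (2 ^ n) (x n) (y n) 0 ->
  (fibp Z2 m).[x] n = (fib_state (2 ^ n) (x n) (y n) r).1.1 /\
  fibdd x y m n = (fib_state (2 ^ n) (x n) (y n) r).2.1.
Proof.
by move=> n0 mE per; rewrite -(fib_state_periodic r e per) -mE fib_stateP.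
Qed.

End FibonacciResidues.

(** * Congruences for indices 22 modulo 48 *)

Section FibonacciChecks.
Implicit Types (x y : Z2) (m d : nat).

(** [96] is a period modulo [16] and [64] of the states that matter, whereas [48]
    is not: the index is reduced to [22] or [70], after the parity of [d]. *)
Lemma index_mod96 d : (22 + 48 * d = (22 + 48 * odd d) + 96 * d./2)%N.
Proof. by rewrite -[in LHS](odd_double_half d) -muln2; lia. Qed.

(** Since [F_m] preserves congruence modulo [2], the slope of [F_m \o F_m]
    between two points of the same parity is thus [3 * 3 = 1] modulo [4]. *)
Lemma fibdd_mod4 m d x y : m = (22 + 48 * d)%N -> x 1 = y 1 ->
  fibdd x y m 2 = 3%N.
Proof.
have check : all (fun a => all (fun b => ((a %% 2 == b %% 2) ==>
    (fib_state (2 ^ 2) a b 48 == fib_state (2 ^ 2) a b 0) &&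
    ((fib_state (2 ^ 2) a b 22).2.1 == 3))%N)
  (iota 0 (2 ^ 2)%N)) (iota 0 (2 ^ 2)%N) by vm_compute.
move=> mE xy1; have /(@Z2res_all _ 2 y) := @Z2res_all _ 2 x check; clear check.
rewrite (@Z2res_modn x 1 2 isT) (@Z2res_modn y 1 2 isT) xy1 eqxx implyTb.
case/andP=> /eqP per /eqP <-.
exact: (fib_residues (n := 2) isT mE per).2.
Qed.

(** As [F_m(0) = 0], this is the cofactor [F_m(x) / x]. The two values have the
    same residue modulo [8] and their squares are both [9] modulo [16]. *)
Lemma fibdd_even m d x : m = (22 + 48 * d)%N -> x 1 = 0%N ->
  fibdd x 0 m 4 = (if odd d then 3 else 11)%N.
Proof.
have check : all (fun a => ((a %% 2 == 0) ==>
    (fib_state (2 ^ 4) a 0 96 == fib_state (2 ^ 4) a 0 0) &&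
    all (fun c : bool => (fib_state (2 ^ 4) a 0 (22 + 48 * c)).2.1 ==
                           if c then 3 else 11) [:: true; false])%N)
  (iota 0 (2 ^ 4)%N) by vm_compute.
rewrite index_mod96 => mE x1; have := @Z2res_all _ 4 x check; clear check.
rewrite (@Z2res_modn x 1 4 isT) x1 eqxx implyTb => /andP[/eqP per /allP].
have dE : odd d \in [:: true; false] by case: (odd d).
move=> /(_ _ dE)/eqP <-; rewrite -[X in fib_state _ _ X _](Z2res_zero 4).
apply: (fib_residues (n := 4) isT mE _).2; rewrite Z2res_zero; exact: per.
Qed.

(** Each step must be known modulo [64] although the first claim is modulo
    [32]: the second claim computes [F_m] at [F_m(x)]. The residue [48 - x] is
    [16 - x], written so that the truncated subtraction is exact. *)
Lemma fibp_odd m d x : m = (22 + 48 * d)%N -> x 1 = 1%N ->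
  (fibp Z2 m).[x] 5 = ((48 - x 5) %% 2 ^ 5)%N /\
  (fibp Z2 m).[(fibp Z2 m).[x]] 6 = ((x 6 + 32) %% 2 ^ 6)%N.
Proof.
pose F (c : bool) (a : nat) := (fib_state (2 ^ 6) a 0 (22 + 48 * c)).1.1.
have check : all (fun a => ((a %% 2 == 1) ==>
    (fib_state (2 ^ 6) a 0 96 == fib_state (2 ^ 6) a 0 0) &&
    all (fun c => [&& F c a %% 2 == 1,
          F c a %% 2 ^ 5 == (48 - a %% 2 ^ 5) %% 2 ^ 5 &
          F c (F c a) == (a + 32) %% 2 ^ 6]) [:: true; false])%N)
  (iota 0 (2 ^ 6)%N) by vm_compute.
rewrite index_mod96 => mE.
have FE y : y 1 = 1%N -> (fibp Z2 m).[y] 6 = F (odd d) (y 6).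
  move=> y1; have := @Z2res_all _ 6 y check; clear check.
  rewrite (@Z2res_modn y 1 6 isT) y1 eqxx implyTb => /andP[/eqP per _].
  rewrite /F -[X in fib_state _ _ X _](Z2res_zero 6).
  apply: (fib_residues (n := 6) isT mE _).1; rewrite Z2res_zero; exact: per.
move=> x1; have := @Z2res_all _ 6 x check; clear check.
rewrite (@Z2res_modn x 1 6 isT) x1 eqxx implyTb => /andP[_ /allP].
have dE : odd d \in [:: true; false] by case: (odd d).
move=> /(_ _ dE); rewrite -(FE x x1) (@Z2res_modn x 5 6 isT).
rewrite (@Z2res_modn _ 1 6 isT) (@Z2res_modn _ 5 6 isT).
by case/and3P=> /eqP /FE -> /eqP -> /eqP ->.
Qed.

Lemma fibp0_even (R : comNzRingType) m : ~~ odd m -> (fibp R m).[0] = 0.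
Proof.
move=> m2; rewrite -(odd_double_half m) (negPf m2) add0n.
elim: (m./2) => [|k IH]; first by rewrite horner0.
by rewrite doubleS fibpS2 mul0r add0r.
Qed.

End FibonacciChecks.

(** * Minimal components *)

Section MinimalComponents.
Implicit Types (f : {poly Z2}) (a b x y : Z2) (E : set Z2).

Lemma orbit_closure_sub f E x : closed E -> fwd_invariant f E -> E x ->
  closure (forward_orbit f x) `<=` E.
Proof.
move=> clE fE Ex; rewrite (proj1 (closure_id E) clE).
apply: closure_subset => _ [n _ <-]; elim: n => //= n IH.
by apply: fE; exists (iter n (horner f) x).
Qed.

(** Both sets are the closure of the orbit of the common point. *)
Lemma minimal_component_eq f E E' x :
  minimal_component f E -> minimal_component f E' -> E x -> E' x -> E = E'.
Proof.
move=> [[_ clE] _ fE [_ mE]] [[_ clE'] _ fE' [_ mE']] Ex E'x.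
by apply/seteqP; split;
  [apply: subset_trans (mE x Ex) _ | apply: subset_trans (mE' x E'x) _];
  apply: orbit_closure_sub.
Qed.

(** [0] is not isolated, since [2 ^ n] tends to [0]. *)
Lemma clopen_nonzero E : clopen E -> E !=set0 -> exists2 x, E x & x != 0.
Proof.
move=> [opE _] [x Ex]; case: (eqVneq x 0) => [x0|]; last by exists x.
have /Z2_nbhsP[n En] : nbhs 0 E by rewrite -x0; apply: open_nbhs_nbhs.
exists (2 ^+ n * 1); first by apply: En; rewrite Z2res_mul2X0 Z2res_zero.
apply/eqP => /(congr1 (fun t : Z2 => t (n + 1)%N)).
rewrite Z2res_mul2X (Z2res_natr 1) Z2res_zero => /eqP.
by rewrite muln1 expn_eq0.
Qed.

(** The second iterate of [f] is an odometer on the union of the two cosets, and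
    one application of [f] passes from either coset to the other. *)
Lemma swapped_cosets_minimal f a b N :
  (0 < N)%N ->
  (forall x y, x 1 = y 1 ->
     exists s : Z2, s 2 = 3%N /\ f.[x] - f.[y] = (x - y) * s) ->
  (forall x, x N = a N -> f.[x] N = b N) ->
  (forall x, x N = b N -> f.[x] N = a N) ->
  (forall x, x N = a N \/ x N = b N ->
     exists u : Z2, u 1 = 1%N /\ f.[f.[x]] = x + 2 ^+ N * u) ->
  minimal_component f (coset2 a N `|` coset2 b N) /\
  forall x, (coset2 a N `|` coset2 b N) x -> ~ periodic_points f x.
Proof.
move=> N0 dif ab ba sq; set E := _ `|` _.
have EP x : E x <-> x N = a N \/ x N = b N by rewrite /E /setU /= !coset2P.
have stE x y : E x -> x N = y N -> E y by rewrite !EP => + <-.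
have fE x : E x -> E f.[x] by rewrite !EP => -[/ab|/ba]; [right|left].
have odo : odometer N E (horner f \o horner f).
  split=> // [x /EP|x y Ex xy]; first exact: sq.
  have xy1 : x 1 = y 1 by apply: Z2res_le xy.
  have [s [s3 e]] := dif _ _ xy1.
  have [|t [t3 e']] := dif f.[x] f.[y].
    have /Z2_eqresP[z xE] := xy1; apply/Z2_eqresP; exists (z * s).
    by apply: (addIr (- f.[y])); rewrite e xE; ring.
  have [w wE] : exists w, s * t = 1 + 2 ^+ 2 * w.
    by apply/Z2_eqresP; rewrite Z2resM s3 t3 (Z2res_natr 1).
  by exists w; rewrite /= e' e -mulrA wE -natrX.
split=> [|x Ex [p p0 pE]]; last first.
  by apply: (odometer_aperiodic odo Ex p0);
    rewrite iter_double -addnn iterD !pE.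
split.
- exact: clopen_residue stE.
- exists [:: (a, 2 * 2 ^- N); (b, 2 * 2 ^- N)].
    by move=> c; rewrite !inE => /orP[] /eqP -> /=;
      rewrite mulr_gt0 // invr_gt0 exprn_gt0.
  apply/seteqP; split=> [x [xa|xb]|x [c]] /=.
  + by exists (a, 2 * 2 ^- N); rewrite /= ?inE ?eqxx // Z2_ballE.
  + by exists (b, 2 * 2 ^- N); rewrite /= ?inE ?eqxx ?orbT // Z2_ballE.
  + by rewrite !inE => /orP[] /eqP -> /=; rewrite Z2_ballE; [left|right].
- by move=> _ [x Ex <-]; apply: fE.
- split; first by exists a; apply/EP; left.
  move=> x Ex y Ey; apply/Z2_closureP => k.
  have [i [Ei yi]] : exists i,
      E (iter i (horner f) x) /\ y N = iter i (horner f) x N.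
    move: (Ex) (Ey) => /EP[] ex /EP[] ey.
    + by exists 0%N; rewrite /= ex ey.
    + by exists 1%N; rewrite /= ab //; split=> //; apply: fE.
    + by exists 1%N; rewrite /= ba //; split=> //; apply: fE.
    + by exists 0%N; rewrite /= ex ey.
  have [j ej] := odometer_transitive k odo Ei yi.
  exists (iter (j.*2 + i) (horner f) x); first by exists (j.*2 + i)%N.
  by rewrite iterD -iter_double; apply: Z2res_le ej; exact: leq_addl.
Qed.

End MinimalComponents.

(** * The components of the decomposition *)

Section Components.
Implicit Types (x y u v : Z2) (n k m d : nat).

(** The second residue is that of [15 - 4 * k + 32], in order to stay within
    natural numbers when [15 < 4 * k]. *)
Lemma Acomp_centers k : (k <= 7)%N ->
  (1 + 4 * k%:R : Z2) 5 = (1 + 4 * k)%N /\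
  (15 - 4 * k%:R : Z2) 5 = ((47 - 4 * k) %% 32)%N.
Proof.
move=> k7; split.
  by rewrite -natrM -(natrD _ 1) Z2res_natr modn_small //; lia.
rewrite -(Z2res_natr (47 - 4 * k) 5); apply/Z2_eqresP; exists (-1).
rewrite natrB; last lia; rewrite natrM; ring.
Qed.

Lemma AcompP k x : (k <= 7)%N ->
  Acomp k x <-> x 5 = (1 + 4 * k)%N \/ x 5 = ((47 - 4 * k) %% 32)%N.
Proof.
move=> k7; rewrite /Acomp /setU /= !coset2P.
by rewrite (Acomp_centers k7).1 (Acomp_centers k7).2.
Qed.

Lemma coset2_scaleP c n k x : coset2 (c * 2 ^+ n) (n + k)%N x <->
  exists2 v : Z2, x = 2 ^+ n * v & v k = c k.
Proof.
rewrite coset2P Z2_eqresP exprD.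
split=> [[z ->]|[v -> /Z2_eqresP[z ->]]]; last by exists z; ring.
by exists (c + 2 ^+ k * z); [ring | apply/Z2_eqresP; exists z].
Qed.

Lemma McompP n k x : Mcomp n k x <->
  exists2 v : Z2, x = 2 ^+ n * v &
    v 3 = ((1 + 4 * k) %% 8)%N \/ v 3 = ((3 + 4 * k) %% 8)%N.
Proof.
rewrite /Mcomp /setU /= !coset2_scaleP -natrM -(natrD _ 1) -(natrD _ 3).
rewrite !Z2res_natr; split=> [[]|] [v -> vk]; first by exists v; [|left].
  by exists v; [|right].
by case: vk => vk; [left|right]; exists v.
Qed.

Lemma Acomp_odd k x : (k <= 7)%N -> Acomp k x -> x 1 = 1%N.
Proof.
move=> k7 /(AcompP _ k7); rewrite -(@Z2res_modn x 1 5 isT) expn1.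
by case=> ->; lia.
Qed.

(** Both [1 + 4 * k] and [3 + 4 * k] are odd, so that every point of [M_{n,k}]
    has valuation exactly [n]. *)
Lemma Mcomp_val n k x : Mcomp n k x ->
  exists u, [/\ x = 2 ^+ n * u, u 1 = 1%N &
    u 3 = ((1 + 4 * k) %% 8)%N \/ u 3 = ((3 + 4 * k) %% 8)%N].
Proof.
move=> /McompP[u -> uk]; exists u; split=> //.
by rewrite -(@Z2res_modn u 1 3 isT) expn1; case: uk => ->; lia.
Qed.

Lemma Z2res1_even n u : (1 <= n)%N -> (2 ^+ n * u) 1 = 0%N.
Proof.
move=> n1; have := @Z2res_le (2 ^+ n * u) 0 _ _ n1.
by rewrite Z2res_mul2X0 !Z2res_zero => ->.
Qed.

Lemma fib_component_neq0 i x : fib_index i -> fib_component i x -> x != 0.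
Proof.
move=> Di Cx; apply/eqP => x0; move: i Di Cx => [k /= k7|[n k] /= [n1 k1]].
  by move/(Acomp_odd k7); rewrite x0 Z2res_zero.
case/Mcomp_val=> u [/esym xu u1 _]; have := Z2res_mul2X n u 1.
by rewrite xu x0 u1 Z2res_zero => /esym/eqP; rewrite muln1 expn_eq0.
Qed.

Lemma fib_component_cover x : x != 0 ->
  exists2 i, fib_index i & fib_component i x.
Proof.
move=> /Z2_val[[|n] [u [u1 ->]]].
  rewrite expr0 mul1r; have := Z2res_lt u 5.
  have := @Z2res_modn u 1 5 isT; rewrite expn1 u1 => u5 lt5.
  have [k k7 ku] : exists2 k, (k <= 7)%N &
      u 5 = (1 + 4 * k)%N \/ u 5 = ((47 - 4 * k) %% 32)%N.
    move: (u 5) u5 lt5 => r r2; rewrite -[(2 ^ 5)%N]/32%N => r32.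
    have [r4|r4] : (r %% 4 = 1 \/ r %% 4 = 3)%N by lia.
      by exists (r %/ 4)%N; lia.
    by exists ((47 - r) %% 32 %/ 4)%N; lia.
  by exists (inl k) => //=; apply/AcompP.
have := Z2res_lt u 3; have := @Z2res_modn u 1 3 isT; rewrite expn1 u1 => u3 lt3.
have [k k1 uk] : exists2 k, (k <= 1)%N &
    u 3 = ((1 + 4 * k) %% 8)%N \/ u 3 = ((3 + 4 * k) %% 8)%N.
  move: (u 3) u3 lt3 => r r2; rewrite -[(2 ^ 3)%N]/8%N => r8.
  by exists (r %/ 4)%N; lia.
by exists (inr (n.+1, k)) => //; apply/McompP; exists u.
Qed.

Lemma fib_component_triv : trivIset fib_index fib_component.
Proof.
have odd_even k n k' x : (k <= 7)%N -> (1 <= n)%N ->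
    Acomp k x -> Mcomp n k' x -> False.
  move=> k7 n1 /(Acomp_odd k7) x1 /Mcomp_val[u [xu _ _]].
  by move: x1; rewrite xu Z2res1_even.
move=> [k|[n k]] [k'|[n' k']] /= Di Dj [x [/= Cx Cx']].
- by move: Cx Cx' => /(AcompP _ Di) h /(AcompP _ Dj) h'; congr inl; lia.
- by case: (odd_even k n' k' x) => //; case: Dj.
- by case: (odd_even k' n k x) => //; case: Di.
case: Di Dj => [n1 k1] [n1' k1'].
move: Cx Cx' => /Mcomp_val[u [xu u1 uk]] /Mcomp_val[v [xv v1 vk]].
have nn' : n = n' by apply: (Z2_val_inj u1 v1); rewrite -xu -xv.
have uv : u 3 = v 3.
  apply/eqP; rewrite -(eqn_pmul2l (expn_gt0 2 n)) -!Z2res_mul2X -xu.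
  by rewrite nn' -xv.
by congr (inr (_, _)) => //; move: uk vk; rewrite uv; lia.
Qed.

Lemma fib_component_minimal m d i : m = (22 + 48 * d)%N -> fib_index i ->
  minimal_component (fibp Z2 m) (fib_component i) /\
  forall x, fib_component i x -> ~ periodic_points (fibp Z2 m) x.
Proof.
move=> mE.
have dif x y : x 1 = y 1 -> exists s : Z2, s 2 = 3%N /\
    (fibp Z2 m).[x] - (fibp Z2 m).[y] = (x - y) * s.
  by move=> xy; exists (fibdd x y m); rewrite fibp_sub (fibdd_mod4 mE).
case: i => [k k7|[n k] [n1 k1]] /=.
  have {}k7 : (k <= 7)%N := k7.
  have E x := @AcompP k x k7.
  apply: swapped_cosets_minimal => // x;
    rewrite ?(Acomp_centers k7).1 ?(Acomp_centers k7).2.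
  - move=> x5.
    have [-> _] := fibp_odd mE (Acomp_odd k7 (proj2 (E x) (or_introl x5))).
    by rewrite x5; lia.
  - move=> x5.
    have [-> _] := fibp_odd mE (Acomp_odd k7 (proj2 (E x) (or_intror x5))).
    by rewrite x5; lia.
  - move=> /(proj2 (E x))/(Acomp_odd k7) x1.
    have [_ ffx] := fibp_odd mE x1.
    have [u fE] : exists u, (fibp Z2 m).[(fibp Z2 m).[x]] = x + 2 ^+ 5 * u.
      apply/Z2_eqresP; rewrite -!(@Z2res_modn _ 5 6 isT) ffx.
      by rewrite modn_dvdm // modnDr.
    exists u; split=> //; move: ffx; rewrite fE Z2res_addX.
    move=> /eqP; rewrite eqn_modDl; have := Z2res_lt u 1.
    by case: (u 1) => [|[|]].
have fv v : exists2 g : Z2, g 4 = (if odd d then 3 else 11)%N &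
    (fibp Z2 m).[2 ^+ n * v] = 2 ^+ n * (v * g).
  exists (fibdd (2 ^+ n * v) 0 m).
    by rewrite (fibdd_even mE) ?Z2res1_even.
  have := fibp_sub (2 ^+ n * v) 0 m.
  rewrite fibp0_even; last by rewrite mE oddD !oddM.
  by rewrite !subr0 mulrA.
have g3 (g : Z2) : g 4 = (if odd d then 3 else 11)%N -> g 3 = 3%N.
  by rewrite -(@Z2res_modn g 3 4 isT) => ->; case: (odd d).
have c3 (c : Z2) : (c + 4 * k%:R : Z2) 3 = ((c 3 + 4 * k) %% 8)%N.
  by rewrite -natrM Z2resD Z2res_natr modnDmr.
(* Multiplication by the cofactor acts as multiplication by [3] on the residue
   modulo [8] of the odd part. *)
have swap (a b : Z2) x : (a 3 * 3 %% 8)%N = b 3 ->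
    x (n + 3)%N = (a * 2 ^+ n) (n + 3)%N ->
    (fibp Z2 m).[x] (n + 3)%N = (b * 2 ^+ n) (n + 3)%N.
  move=> ab /coset2P/coset2_scaleP[v -> va]; apply/coset2P/coset2_scaleP.
  have [g /g3 g3E ->] := fv v; exists (v * g) => //.
  by rewrite Z2resM va g3E.
apply: swapped_cosets_minimal => // [|x|x|x].
- by rewrite addn3.
- by apply: swap; rewrite !c3 (Z2res_natr 1) (Z2res_natr 3); lia.
- by apply: swap; rewrite !c3 (Z2res_natr 1) (Z2res_natr 3); lia.
move=> h; have /Mcomp_val[v [-> v1 _]] : Mcomp n k x.
  by case: h => h; [left|right]; apply/coset2P.
have [g g4 ->] := fv v; have [g' g4' ->] := fv (v * g).
have [w wE] : exists w, g * g' = 1 + 2 ^+ 3 * w.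
  apply/Z2_eqresP; rewrite Z2resM (g3 _ g4) (g3 _ g4').
  by rewrite (Z2res_natr 1).
(* [3 * 3], [11 * 11] are both [9] modulo [16], that is [1 + 8 * odd]. *)
have w1 : w 1 = 1%N.
  have := Z2res_addX 1 3 w; rewrite -wE Z2resM g4 g4' (Z2res_natr 1).
  by have := Z2res_lt w 1; case: (w 1) => [|[|]] //; case: (odd d).
exists (v * w); split; first by rewrite Z2resM v1 w1.
by rewrite -mulrA wE exprD; ring.
Qed.

End Components.

Theorem theorem9p4 (m q d : nat)
    (hm : m = (10 + 12 * q)%N) (hq : q = (1 + 4 * d)%N) :
  minimal_decomposition (fibp Z2 m)
    [set 0]
    ((\bigcup_(k in [set k : nat | (k <= 7)%N]) Acomp k) `|`
     (\bigcup_(n in [set n : nat | (1 <= n)%N])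
        \bigcup_(k in [set k : nat | (k <= 1)%N]) Mcomp n k))
    set0
    fib_index fib_component
  /\ (fibp Z2 m).[0] = 0.
Proof.
have mE : m = (22 + 48 * d)%N by rewrite hm hq; lia.
clear hm hq q.
have f0 : (fibp Z2 m).[0] = 0 by rewrite fibp0_even // mE oddD !oddM.
set M := _ `|` _; split=> //.
have ME : M = \bigcup_(i in fib_index) fib_component i.
  apply/seteqP; split=> x.
    by case=> [[k k7 Cx]|[n n1 [k k1 Cx]]];
      [exists (inl k)|exists (inr (n, k))].
  case=> [[k|[n k]]] /= Di Cx; first by left; exists k.
  by case: Di => n1 k1; right; exists n => //; exists k.
have minC i := @fib_component_minimal m d i mE.
have M0 x : M x <-> x != 0.
  rewrite ME; split=> [[i Di Cx]|/fib_component_cover[i Di Cx]].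
    exact: fib_component_neq0 Cx.
  by exists i.
split=> //.
- rewrite setU0; apply/esym/seteqP; split=> // x _.
  by case: (eqVneq x 0) => [->|/M0]; [left|right].
- by apply/seteqP; split=> // x [/= -> /M0]; rewrite eqxx.
- by rewrite setI0.
- by rewrite setI0.
- apply/seteqP; split=> [x /= ->|x px]; first by exists 1%N.
  apply: contrapT => /eqP/fib_component_cover[i Di Cx].
  exact: (proj2 (minC i Di) x Cx px).
- exact: fib_component_triv.
- apply/seteqP; split=> [_ [i Di <-]|E mE']; first exact: (proj1 (minC i Di)).
  have [clE _ _ [E0 _]] := mE'.
  have [x Ex /fib_component_cover[i Di Cx]] := clopen_nonzero clE E0.
  by exists i => //;
    apply: (minimal_component_eq (proj1 (minC i Di)) mE' Cx Ex).
Qed.
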